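(* There exists a hereditarily closed family of finite $3$-partite $3$-hypergraphs satisfying strong stable regularity, but not approximately perfect stable regularity.
   Context: A finite $3$-partite $3$-hypergraph is $H=(E;X_1,X_2,X_3)$ with $X_i$ finite nonempty sets and $E\subseteq X_1\times X_2\times X_3$. A family $\mathcal{H}$ is hereditarily closed if whenever $(E;X_1,X_2,X_3)\in\mathcal{H}$ and $\emptyset\ne X_i'\subseteq X_i$, also $(E\cap\prod_iX_i';X_1',X_2',X_3')\in\mathcal{H}$. $\mathcal{H}$ satisfies: - approximately perfect stable regularity if for every $\varepsilon>0$ and every $f:\mathbb{N}\to(0,1)$ there is $N=N(f,\varepsilon)$ so that for any $H\in\mathcal{H}$ there exist $N'\le N$ and partitions $X_i=\bigsqcup_{0\le t<N'}A_{i,t}$ ($1\le i\le3$) with (a) $|A_{i,0}|\le\varepsilon|X_i|$ for all $i$; (b) for any $1\le i\le3$ and $1\le t<N'$, $\frac{|A_{i,t}\cap E_b|}{|A_{i,t}|}\in[0,f(N'))\cup(1-f(N'),1]$ for all but at most an $f(N')$ fraction of the tuples $b\in\prod_{j\ne i}X_j$, where $E_b\subseteq X_i$ is the fiber of $E$ at $b$; - strong stable regularity if for every $\varepsilon>0$ and every $f:\mathbb{N}\to(0,1]$ there is $N=N(f,\varepsilon)$ so that for any $H\in\mathcal{H}$ there exist $N'\le N$ and partitions $X_i=\bigsqcup_{0\le t<N'}A_{i,t}$ with (a) $|A_{i,0}|\le\varepsilon|A_{i,1}|$ for all $i$; (b) for any $1\le t_1,t_2,t_3<N'$, $\frac{|E\cap(A_{1,t_1}\times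 A_{2,t_2}\times A_{3,t_3})|}{|A_{1,t_1}\times A_{2,t_2}\times A_{3,t_3}|}\in[0,f(N'))\cup(1-f(N'),1]$. Convention: parts of partitions may be empty; conditions on a ratio are only required when the denominator is nonzero. *)

(* Defs.v *)
From HB Require Import structures.
From mathcomp Require Import all_boot all_order all_algebra.
From mathcomp Require Import reals.

Set Implicit Arguments.
Unset Strict Implicit.
Unset Printing Implicit Defensive.

Import Order.TTheory GRing.Theory Num.Theory.

Local Open Scope ring_scope.

Record hypergraph := Hypergraph {
  V1 : finType;
  V2 : finType;
  V3 : finType;
  edges : {set V1 * V2 * V3};
  V1_gt0 : (0 < #|V1|)%N;
  V2_gt0 : (0 < #|V2|)%N;
  V3_gt0 : (0 < #|V3|)%N
}.

Lemma card_sig_gt0 (T : finType) (A : {set T}) :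
  A != set0 -> (0 < #|{: {x : T | x \in A}}|)%N.
Proof. by rewrite card_sig -card_gt0. Qed.

(* The vertex sets of an induced subhypergraph are the subtypes of the
   elements of the [A_i]. *)
Definition induced (H : hypergraph)
    (A1 : {set V1 H}) (A2 : {set V2 H}) (A3 : {set V3 H})
    (A1_neq0 : A1 != set0) (A2_neq0 : A2 != set0) (A3_neq0 : A3 != set0) :
    hypergraph :=
  @Hypergraph {x | x \in A1} {x | x \in A2} {x | x \in A3}
    [set e | (val e.1.1, val e.1.2, val e.2) \in edges H]
    (card_sig_gt0 A1_neq0) (card_sig_gt0 A2_neq0) (card_sig_gt0 A3_neq0).

Definition hereditarily_closed (F : hypergraph -> Prop) : Prop :=
  forall H : hypergraph, F H ->
  forall (A1 : {set V1 H}) (A2 : {set V2 H}) (A3 : {set V3 H})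
    (A1_neq0 : A1 != set0) (A2_neq0 : A2 != set0) (A3_neq0 : A3 != set0),
  F (induced A1_neq0 A2_neq0 A3_neq0).

Definition fiber1 (H : hypergraph) (b : V2 H * V3 H) : {set V1 H} :=
  [set x | (x, b.1, b.2) \in edges H].
Definition fiber2 (H : hypergraph) (b : V1 H * V3 H) : {set V2 H} :=
  [set x | (b.1, x, b.2) \in edges H].
Definition fiber3 (H : hypergraph) (b : V1 H * V2 H) : {set V3 H} :=
  [set x | (b.1, b.2, x) \in edges H].

(* A partition into [n] possibly empty labelled parts is a map to ['I_n].
   The label [t] is a natural number: [part p t] is empty when [n <= t]. *)
Definition part (T : finType) (n : nat) (p : T -> 'I_n) (t : nat) : {set T} :=
  [set x | p x == t :> nat].

Definition density (R : realType) (T : finType) (A S : {set T}) : R :=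
  #|A :&: S|%:R / #|A|%:R.

Definition near01 (R : realType) (e d : R) : bool :=
  (d \in `[0, e[) || (d \in `]1 - e, 1]).

Definition perfect_parts (R : realType) (T U : finType) (S : U -> {set T})
    (n : nat) (p : T -> 'I_n) (e : R) : Prop :=
  forall t : nat, (1 <= t < n)%N -> part p t != set0 ->
  #|[set b : U | ~~ near01 e (density R (part p t) (S b))]|%:R
    <= e * #|U|%:R.

Definition approx_perfect_stable_regularity (R : realType)
    (F : hypergraph -> Prop) : Prop :=
  forall (eps : R) (f : nat -> R), 0 < eps -> (forall n, 0 < f n < 1) ->
  exists N : nat, forall H : hypergraph, F H ->
  exists n : nat, (n <= N)%N /\
  exists (p1 : V1 H -> 'I_n) (p2 : V2 H -> 'I_n) (p3 : V3 H -> 'I_n),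
    [/\ #|part p1 0|%:R <= eps * #|V1 H|%:R,
        #|part p2 0|%:R <= eps * #|V2 H|%:R
      & #|part p3 0|%:R <= eps * #|V3 H|%:R] /\
    [/\ perfect_parts (@fiber1 H) p1 (f n),
        perfect_parts (@fiber2 H) p2 (f n)
      & perfect_parts (@fiber3 H) p3 (f n)].

(* When [n = 1] the part [part p1 1] is empty, so the bound on [part p1 0]
   fails, [V1 H] being nonempty; hence [n >= 2] is forced. *)
Definition strong_stable_regularity (R : realType)
    (F : hypergraph -> Prop) : Prop :=
  forall (eps : R) (f : nat -> R), 0 < eps -> (forall n, 0 < f n <= 1) ->
  exists N : nat, forall H : hypergraph, F H ->
  exists n : nat, (n <= N)%N /\
  exists (p1 : V1 H -> 'I_n) (p2 : V2 H -> 'I_n) (p3 : V3 H -> 'I_n),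
    [/\ #|part p1 0|%:R <= eps * #|part p1 1|%:R,
        #|part p2 0|%:R <= eps * #|part p2 1|%:R
      & #|part p3 0|%:R <= eps * #|part p3 1|%:R] /\
    forall t1 t2 t3 : nat,
      (1 <= t1 < n)%N -> (1 <= t2 < n)%N -> (1 <= t3 < n)%N ->
      let B := setX (setX (part p1 t1) (part p2 t2)) (part p3 t3) in
      B != set0 -> near01 (f n) (density R B (edges H)).

(* Main.v *)
(* Witness: hypergraphs whose edges are the [(x, y, z)] with [c1 x = c2 y] and
   [z] in [Q (c1 x)], for arbitrary colorings [c1], [c2] and arbitrary sets
   [Q i].

   Strong regularity: for a rapidly decreasing sequence of thresholds, some two
   consecutive thresholds have little mass of [V2] in color classes of
   intermediate size.  These classes go to the exceptional part of [V2].  The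
   boundedly many heavier classes become parts, split [V3] by their sets [Q i],
   and give boxes of density 0 or 1; the union of the lighter classes gives
   boxes of small density, since no single color is frequent in it.

   Failure of approximately perfect regularity: no part may be discarded from
   the tuples [b].  Let the i-th color have relative measure about [2^-i] in
   both [V1] and [V2], and let [Q i] be the i-th coordinate halfspace of a cube
   [V3].  If [f n] is below [4^-n], then each nonexceptional part of [V3] must
   be almost constant in each of the first [n] coordinates, so [n] parts cover
   too little of the cube. *)

Require Import Defs.
From mathcomp Require Import all_boot all_order all_algebra.
From mathcomp Require Import reals lra zify.

Set Implicit Arguments.
Unset Strict Implicit.
Unset Printing Implicit Defensive.

Import Order.TTheory GRing.Theory Num.Theory.

Local Open Scope ring_scope.

(** * The family of matching hypergraphs *)

Definition matching_hypergraph (H : hypergraph) : Prop :=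
  exists (K : finType) (c1 : V1 H -> K) (c2 : V2 H -> K) (Q : K -> {set V3 H}),
  forall x y z, ((x, y, z) \in edges H) = (c1 x == c2 y) && (z \in Q (c1 x)).

Lemma matching_hypergraph_hereditary : hereditarily_closed matching_hypergraph.
Proof.
move=> H [K [c1 [c2 [Q HE]]]] A1 A2 A3 h1 h2 h3.
exists K, (fun x => c1 (val x)), (fun y => c2 (val y)).
exists (fun i => [set z | val z \in Q i]) => x y z.
by rewrite !inE /= HE.
Qed.

(** * Boxes of density near 0 or 1 *)

Lemma near01_lt (R : realType) (T : finType) (A S : {set T}) (e : R) :
  A != set0 -> #|A :&: S|%:R < e * #|A|%:R -> near01 e (density R A S).
Proof.
rewrite -card_gt0 -(ltr0n R) => A0 AS; apply/orP; left.
by rewrite in_itv /= divr_ge0 //= ltr_pdivrMr.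
Qed.

Lemma near01_const (R : realType) (T : finType) (A S : {set T}) (e : R) x0 :
  0 < e -> x0 \in A -> {in A, forall x, (x \in S) = (x0 \in S)} ->
  near01 e (density R A S).
Proof.
move=> e0 Ax0 AS.
have A0 : A != set0 by apply/set0Pn; exists x0.
case: (boolP (x0 \in S)) => Sx0.
  have /setIidPl AI : A \subset S by apply/subsetP => x /AS ->.
  rewrite /near01 /density AI divff ?pnatr_eq0 ?cards_eq0 //.
  by apply/orP; right; rewrite in_itv /= lexx andbT; lra.
apply: near01_lt => //; have -> : A :&: S = set0.
  by apply/setP => x; rewrite !inE; apply/andP => -[/AS ->]; apply/negP.
by rewrite cards0 mulr_gt0 // ltr0n card_gt0.
Qed.

Definition color_class (T K : finType) (c : T -> K) (i : K) : {set T} :=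
  [set x | c x == i].

(** Project the edges to the pairs [(x, z)]: over such a pair only [y] varies, and it must have the
    color of [x]. *)
Lemma card_edges_box (H : hypergraph) (K : finType)
    (c1 : V1 H -> K) (c2 : V2 H -> K)
    (A1 : {set V1 H}) (A2 : {set V2 H}) (A3 : {set V3 H}) :
  (forall x y z, (x, y, z) \in edges H -> c1 x = c2 y) ->
  (#|setX (setX A1 A2) A3 :&: edges H| <=
     \sum_(q in setX A1 A3) #|A2 :&: color_class c2 (c1 q.1)|)%N.
Proof.
move=> HE; pose proj (e : V1 H * V2 H * V3 H) := (e.1.1, e.2).
rewrite -sum1_card (partition_big proj (mem (setX A1 A3))) /=; last first.
  by move=> -[[x y] z]; rewrite !inE /= => /andP[/andP[/andP[-> _] ->]].
apply: leq_sum => q _; rewrite sum1_card.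
apply: leq_trans (leq_imset_card (fun y => (q.1, y, q.2)) _).
apply/subset_leq_card/subsetP => -[[x y] z].
rewrite unfold_in /= !inE /= => /andP[/andP[/andP[/andP[_ A2y] _] Exyz] /eqP <-] /=.
by apply/imsetP; exists y => //; rewrite !inE A2y (HE _ _ _ Exyz) /=.
Qed.

Lemma near01_sparse_box (R : realType) (H : hypergraph) (K : finType)
    (c1 : V1 H -> K) (c2 : V2 H -> K)
    (A1 : {set V1 H}) (A2 : {set V2 H}) (A3 : {set V3 H}) (e : R) :
  (forall x y z, (x, y, z) \in edges H -> c1 x = c2 y) ->
  (forall i, #|A2 :&: color_class c2 i|%:R < e * #|A2|%:R) ->
  setX (setX A1 A2) A3 != set0 ->
  near01 e (density R (setX (setX A1 A2) A3) (edges H)).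
Proof.
move=> HE sparse B0; apply: near01_lt => //.
have /set0Pn[[[x y] z]] := B0; rewrite !inE /= => /andP[/andP[A1x _] A3z].
apply: (@le_lt_trans _ _
  (\sum_(q in setX A1 A3) #|A2 :&: color_class c2 (c1 q.1)|%:R)).
  by rewrite -natr_sum ler_nat; apply: card_edges_box.
apply: (@lt_le_trans _ _ (\sum_(q in setX A1 A3) e * #|A2|%:R)).
  (* A strict inequality between sums needs an index; a point of the box provides one. *)
  apply: ltr_sum => //; apply/hasP; exists (x, z); rewrite ?mem_index_enum //.
  by rewrite !inE /= A1x.
rewrite sumr_const !cardsX -mulrnAr -mulrnA.
by rewrite mulnC mulnAC.
Qed.

(** * Heavy colors and the partition they define *)

Definition heavy (R : realType) (T K : finType) (c : T -> K) (r : R) : {set K} :=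
  [set i | r * #|T|%:R <= #|color_class c i|%:R].

Lemma card_heavy (R : realType) (T K : finType) (c : T -> K) (r : R) :
  (0 < #|T|)%N -> 0 < r -> (#|heavy c r| <= Num.bound r^-1)%N.
Proof.
move=> T0 r0; rewrite -(ler_nat R).
have ri0 : 0 <= r^-1 by rewrite invr_ge0 ltW.
apply: le_trans (ltW (archi_boundP ri0)).
rewrite -[leRHS]mul1r ler_pdivlMr //.
rewrite -(ler_pM2r (_ : 0 < #|T|%:R)) ?ltr0n // mul1r -mulrA.
have heavy_sum : (\sum_(i in heavy c r) #|color_class c i| <= #|T|)%N.
  rewrite -[leqRHS]sum1_card [leqRHS](partition_big c predT) //=.
  rewrite [leqRHS](bigID (mem (heavy c r))) /=; apply: leq_trans (leq_addr _ _).
  by apply: leq_sum => i _; rewrite sum1_card cardsE.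
apply: le_trans (_ : _ <= (\sum_(i in heavy c r) #|color_class c i|)%:R) _.
  rewrite natr_sum mulr_natl -sumr_const; apply: ler_sum => i.
  by rewrite inE.
by rewrite ler_nat.
Qed.

Lemma heavy_le (R : realType) (T K : finType) (c : T -> K) (r r' : R) :
  r' <= r -> heavy c r \subset heavy c r'.
Proof.
by move=> r'r; apply/subsetP => i; rewrite !inE; apply: le_trans; rewrite ler_wpM2r.
Qed.

(** Pigeonhole: the differences for distinct [j] are disjoint, so more than [d^-1] of them cannot
    all have relative measure above [d]. *)
Lemma heavy_gap (R : realType) (T K : finType) (c : T -> K) (r : nat -> R) (d : R) :
  (0 < #|T|)%N -> 0 < d -> (forall j, r j.+1 <= r j) ->
  exists2 j, (j < Num.bound d^-1)%N &
    #|c @^-1: heavy c (r j.+1) :\: c @^-1: heavy c (r j)|%:R <= d * #|T|%:R.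
Proof.
move=> T0 d0 r_decr; set M := Num.bound _.
case: (boolP [exists j : 'I_M,
    #|c @^-1: heavy c (r j.+1) :\: c @^-1: heavy c (r j)|%:R <= d * #|T|%:R]).
  by move=> /existsP[j dj]; exists j.
rewrite negb_exists => /forallP gap; exfalso.
have growth j : (j <= M)%N -> j%:R * (d * #|T|%:R) <= #|c @^-1: heavy c (r j)|%:R :> R.
  elim: j => [|j IHj] jM; first by rewrite mul0r.
  have := gap (Ordinal jM); rewrite -ltNge /= => /ltW gapj.
  rewrite -natr1 mulrDl mul1r; apply: le_trans (lerD (IHj (ltnW jM)) gapj) _.
  rewrite -natrD ler_nat cardsD (setIidPr _) ?subnKC //.
    by apply/subset_leq_card/preimsetS/heavy_le.
  exact/preimsetS/heavy_le.
have := growth M (leqnn _); apply/negP; rewrite -ltNge.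
apply: (@le_lt_trans _ _ (1 * #|T|%:R)); first by rewrite mul1r ler_nat max_card.
rewrite mulrA ltr_pM2r ?ltr0n // -ltr_pdivrMr // mul1r.
by apply: archi_boundP; rewrite invr_ge0 ltW.
Qed.

(* Labels 0 to [m + 1] serve for [V1] and [V2], labels 1 to [2 ^ m] for [V3]. *)
Definition parts_bound (m : nat) : nat := (#|{set 'I_m}| + m).+2.

Lemma part_inord (T : finType) (n : nat) (l : T -> nat) (t : nat) :
  (forall x, l x <= n)%N -> part (fun x => inord (l x) : 'I_n.+1) t = [set x | l x == t].
Proof. by move=> ln; apply/setP => x; rewrite !inE inordK // ltnS. Qed.

(** The list [s] holds the colors that get a part of their own; all other colors share one label,
    and label 0 is kept for [D]. The color [i0] comes first in [s] because the exceptional part must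
    be compared with part 1. *)
Lemma matching_partition (R : realType) (H : hypergraph) (K : finType)
    (c1 : V1 H -> K) (c2 : V2 H -> K) (Q : K -> {set V3 H})
    (i0 : K) (s : seq K) (m : nat) (D : {set V2 H}) (e : R) :
  (forall x y z, ((x, y, z) \in edges H) = (c1 x == c2 y) && (z \in Q (c1 x))) ->
  i0 \in s -> index i0 s = 0%N -> (size s <= m)%N -> 0 < e ->
  {in D, forall y, c2 y \notin s} ->
  (let A := [set y | c2 y \notin s] :\: D in
   A != set0 -> forall i, #|A :&: color_class c2 i|%:R < e * #|A|%:R) ->
  exists (p1 : V1 H -> 'I_(parts_bound m)) (p2 : V2 H -> 'I_(parts_bound m))
         (p3 : V3 H -> 'I_(parts_bound m)),
    [/\ part p1 0 = set0, part p2 0 = D, part p3 0 = set0 &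
        color_class c2 i0 \subset part p2 1] /\
    forall t1 t2 t3 : nat, (0 < t2)%N ->
      let B := setX (setX (part p1 t1) (part p2 t2)) (part p3 t3) in
      B != set0 -> near01 e (density R B (edges H)).
Proof.
move=> HE i0s index_i0 size_s e0 Ds sparse.
pose l1 x := (index (c1 x) s).+1.
pose l2 y := if y \in D then 0%N else (index (c2 y) s).+1.
(* Positions past the end of [s] default to [i0], so they only repeat the bit of position 0. *)
pose pat z := [set k : 'I_m | z \in Q (nth i0 s k)].
pose l3 z := (enum_rank (pat z)).+1.
have index_le c : (index c s <= m)%N.
  by apply: leq_trans (index_size _ _) size_s.
have l1P x : (l1 x <= (#|{set 'I_m}| + m).+1)%N.
  by rewrite ltnS (leq_trans (index_le _)) // leq_addl.
have l2P y : (l2 y <= (#|{set 'I_m}| + m).+1)%N.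
  by rewrite /l2; case: ifP => // _; rewrite ltnS (leq_trans (index_le _)) // leq_addl.
have l3P z : (l3 z <= (#|{set 'I_m}| + m).+1)%N.
  by rewrite ltnS ltnW // (leq_trans (ltn_ord _)) // leq_addr.
exists (fun x => inord (l1 x)), (fun y => inord (l2 y)), (fun z => inord (l3 z)).
rewrite !part_inord //; split.
  split; [by apply/setP => x; rewrite !inE| |by apply/setP => x; rewrite !inE|].
    by apply/setP => y; rewrite !inE /l2; case: ifP.
  apply/subsetP => y; rewrite !inE /l2 => /eqP cy.
  case: ifP => [/Ds|_]; first by rewrite cy i0s.
  by rewrite cy index_i0.
move=> t1 t2 t3 t20; rewrite !part_inord // => B B0.
have /set0Pn[[[x0 y0] z0] Bxyz0] := B0.
have := Bxyz0; rewrite !inE /= => /andP[/andP[/eqP l1x0 /eqP l2y0] /eqP l3z0].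
have Dy y : l2 y = t2 -> y \notin D.
  by rewrite /l2; case: ifP => // _ t2E; rewrite -t2E in t20.
have [y0s|y0s] := boolP (c2 y0 \in s); last first.
  (* Every unlisted color has index [size s], so this part of [V2] is the whole remainder. *)
  have restE : [set y | l2 y == t2] = [set y | c2 y \notin s] :\: D.
    apply/setP => y; rewrite !inE -l2y0 /l2 (negPf (Dy _ l2y0)).
    case: ifP => //= _; rewrite eqSS; apply/eqP/idP => [iy|].
      by rewrite -index_mem iy index_mem.
    by move: y0s; rewrite -!index_mem -!leqNgt; have := index_size (c2 y) s;
       have := index_size (c2 y0) s; lia.
  apply: (near01_sparse_box (c1 := c1) (c2 := c2)) => //.
    by move=> x y z; rewrite HE => /andP[/eqP].
  rewrite restE; apply: sparse; apply/set0Pn; exists y0.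
  by rewrite -restE inE l2y0.
(* With a listed color on the [V2] side, the labels fix whether the colors agree, and the pattern
   fixes membership in the corresponding [Q]: the box is full or empty. *)
have edgeE x y z : l1 x = t1 -> l2 y = t2 -> l3 z = t3 ->
    ((x, y, z) \in edges H) = (t1 == t2) && (z0 \in Q (c2 y0)).
  move=> l1x l2y l3z.
  have -> : ((x, y, z) \in edges H) = (c1 x == c2 y0) && (z \in Q (c2 y0)).
    rewrite HE; suff -> : c2 y = c2 y0 by case: eqP => // ->.
    move: (l2y); rewrite -l2y0 /l2 (negPf (Dy _ l2y0)) (negPf (Dy _ l2y)) => -[iy].
    by rewrite -[LHS](@nth_index _ i0 _ s) ?iy ?nth_index // -index_mem iy index_mem.
  congr andb.
    rewrite -l1x -l2y0 /l1 /l2 (negPf (Dy _ l2y0)) eqSS.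
    apply/eqP/eqP => [->//|ix]; rewrite -[LHS](@nth_index _ i0 _ s) ?ix ?nth_index //.
    by rewrite -index_mem ix index_mem.
  have im : (index (c2 y0) s < m)%N by apply: leq_trans size_s; rewrite index_mem.
  have /setP/(_ (Ordinal im)) : pat z = pat z0.
    by move: l3z; rewrite -l3z0 => -[/val_inj/enum_rank_inj].
  by rewrite !inE /= nth_index.
apply: (near01_const (x0 := (x0, y0, z0))) => // -[[x y] z].
rewrite !inE /= => /andP[/andP[/eqP l1x /eqP l2y] /eqP l3z].
by rewrite !edgeE.
Qed.

(** * Strong stable regularity *)

Lemma matching_strong (R : realType) : strong_stable_regularity R matching_hypergraph.
Proof.
move=> eps f eps0 f01.
have f0 n : 0 < f n by case/andP: (f01 n).
(* Part 1 of [V2] will contain a class of relative measure at least [c], so the exceptional part may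
   have measure [eps * c]. It is a union of two sets, each allowed measure [d]. *)
pose c := f 2; pose d := eps * c / 2.
have d0 : 0 < d by apply: divr_gt0 (mulr_gt0 eps0 (f0 2)) (ltr0Sn _ 1).
pose size_bound (r : R) := Num.bound r^-1.
(* The argument of [f] is the number of parts used when the colors heavy for [r] are listed. A color
   lighter than [next r] then has share below that value of [f] in any set of relative measure at
   least [d]. *)
pose next (r : R) := Num.min r (d * f (parts_bound (size_bound r))).
pose r j := iter j next c.
have r0 j : 0 < r j.
  elim: j => [|j IHj]; first exact: f0.
  by rewrite /r iterS /next lt_min IHj mulr_gt0.
have r_decr j : r j.+1 <= r j by rewrite /r iterS /next ge_min lexx.
have r_next j : r j.+1 <= d * f (parts_bound (size_bound (r j))).
  by rewrite {1}/r iterS /next ge_min lexx orbT.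
(* The sum dominates the number of parts for whichever [j] the gap argument selects; 2 serves the
   case without frequent colors. *)
exists (2 + \sum_(j < Num.bound d^-1) parts_bound (size_bound (r j)))%N.
move=> H [K [c1 [c2 [Q HE]]]].
have edgeP x y z : (x, y, z) \in edges H -> c1 x = c2 y.
  by rewrite HE => /andP[/eqP].
have [/existsP[i0 i0_heavy]|] :=
  boolP [exists i, c * #|V2 H|%:R <= #|color_class c2 i|%:R]; last first.
  rewrite negb_exists => /forallP light.
  (* No color has relative measure [f 2] in [V2], so the full vertex sets form a single sparse
     box. *)
  exists 2; split; first exact: leq_addr.
  exists (fun=> inord 1), (fun=> inord 1), (fun=> inord 1).
  have part0 (T : finType) : part (fun _ : T => inord 1 : 'I_2) 0 = set0.
    by apply/setP => x; rewrite !inE inordK.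
  have part1 (T : finType) : part (fun _ : T => inord 1 : 'I_2) 1 = setT.
    by apply/setP => x; rewrite !inE inordK.
  rewrite !part0 !cards0 !part1; split.
    by split; rewrite mulr_ge0 // ltW.
  move=> t1 t2 t3; have t_eq1 t : (1 <= t < 2)%N -> t = 1%N by case: t => [|[]].
  move=> /t_eq1-> /t_eq1-> /t_eq1->; rewrite !part1 => B B0.
  apply: (near01_sparse_box (c1 := c1) (c2 := c2)) => // i.
  by rewrite setTI cardsT ltNge light.
have [j jM gap] := heavy_gap c2 (V2_gt0 H) d0 r_decr.
set n := parts_bound (size_bound (r j)).
pose s := i0 :: rem i0 (enum (heavy c2 (r j))).
have r_le_c i : r i <= c by elim: i => //= i IHi; exact: le_trans (r_decr i) IHi.
have i0_in : i0 \in heavy c2 (r j).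
  by rewrite inE (le_trans _ i0_heavy) // ler_wpM2r.
have sE i : (i \in s) = (i \in heavy c2 (r j)).
  by rewrite -(perm_mem (perm_to_rem _)) mem_enum.
have size_s : (size s <= size_bound (r j))%N.
  rewrite -(perm_size (perm_to_rem _)) ?mem_enum // -cardE.
  exact: card_heavy (V2_gt0 H) (r0 j).
pose M := c2 @^-1: heavy c2 (r j.+1) :\: c2 @^-1: heavy c2 (r j).
pose L := [set y | c2 y \notin heavy c2 (r j.+1)].
(* The light colors [L] are discarded along with the gap [M] when [L] is too small for each of its
   colors to be rare in it. *)
pose D := M :|: (if #|L|%:R < d * #|V2 H|%:R then L else set0).
have inM y : (y \in M) = (c2 y \notin heavy c2 (r j)) && (c2 y \in heavy c2 (r j.+1)).
  by rewrite !inE.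
have inL y : (y \in L) = (c2 y \notin heavy c2 (r j.+1)) by rewrite !inE.
have heavyS y : c2 y \in heavy c2 (r j) -> c2 y \in heavy c2 (r j.+1).
  exact/subsetP/heavy_le.
have Ds : {in D, forall y, c2 y \notin s}.
  move=> y; rewrite sE in_setU inM => /orP[/andP[]//|].
  by case: ifP => _; rewrite ?in_set0 // inL; apply/contra/heavyS.
have cardD : #|D|%:R <= eps * (c * #|V2 H|%:R).
  have -> : eps * (c * #|V2 H|%:R) = d * #|V2 H|%:R + d * #|V2 H|%:R.
    by rewrite -mulrDl /d -splitr mulrA.
  apply: (@le_trans _ _ (#|M| + #|if #|L|%:R < d * #|V2 H|%:R then L else set0|)%:R).
    by rewrite ler_nat; apply: leq_card_setU.
  rewrite natrD lerD //.
  by case: ifP => [/ltW //|_]; rewrite cards0 mulr_ge0 // ltW.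
have sparse : let A := [set y | c2 y \notin s] :\: D in
    A != set0 -> forall i, #|A :&: color_class c2 i|%:R < f n * #|A|%:R.
  move=> A A0.
  have inA y : (y \in A) = (y \notin D) && (c2 y \notin heavy c2 (r j)).
    by rewrite in_setD -sE; congr andb; rewrite inE.
  have AL : A \subset L.
    apply/subsetP => y; rewrite inA inL in_setU inM negb_or.
    by move=> /andP[/andP[]]; case: (c2 y \in heavy c2 (r j)).
  have [small|large] := ltP #|L|%:R (d * #|V2 H|%:R).
    have /set0Pn[y Ay] := A0; have yL := subsetP AL y Ay.
    by move: Ay; rewrite inA in_setU small yL orbT.
  have -> : A = L.
    apply/eqP; rewrite eqEsubset AL; apply/subsetP => y.
    rewrite inA inL in_setU ltNge large /= in_set0 orbF inM => yL.
    by rewrite (negPf yL) andbF /=; apply: contra yL; apply: heavyS.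
  (* Heavy colors do not meet [L]; a light class has fewer than [d * f n * #|V2 H|] points, which is
     at most [f n * #|L|]. *)
  move=> i; have [ih|il] := boolP (i \in heavy c2 (r j.+1)).
    rewrite (_ : L :&: _ = set0) ?cards0.
      by rewrite mulr_gt0 // (lt_le_trans _ large) // mulr_gt0 // ltr0n V2_gt0.
    apply/setP => y; rewrite !inE; apply/andP => -[yL /eqP cy].
    by move: yL; rewrite cy => /negP; apply; move: ih; rewrite inE.
  apply: (@le_lt_trans _ _ #|color_class c2 i|%:R).
    by rewrite ler_nat subset_leq_card // subsetIr.
  move: il; rewrite inE -ltNge => /lt_le_trans; apply.
  apply: (@le_trans _ _ (d * f n * #|V2 H|%:R)); first by rewrite ler_wpM2r.
  by rewrite mulrAC mulrC ler_pM2l.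
have i0s : i0 \in s by exact: mem_head.
have index_i0 : index i0 s = 0%N by rewrite /s /= eqxx.
have [p1 [p2 [p3 [[p10 p20 p30 p21] dens]]]] :=
  matching_partition HE i0s index_i0 size_s (f0 n) Ds sparse.
exists n; split.
  apply: leq_trans (leq_addl _ _).
  by rewrite (bigD1 (Ordinal jM)) //= leq_addr.
exists p1, p2, p3; rewrite p10 p20 p30 !cards0; split.
  split; [by rewrite mulr_ge0 ?(ltW eps0)| |by rewrite mulr_ge0 ?(ltW eps0)].
  apply: le_trans cardD _; rewrite ler_pM2l //; apply: le_trans i0_heavy _.
  by rewrite ler_nat subset_leq_card.
by move=> t1 t2 t3 _ /andP[t2_gt0 _] _ B; exact: dens.
Qed.

(** * Halfspaces of the cube and the hypergraphs built from them *)

Lemma card_cylinder (L n : nat) (s : 'I_L -> bool) : (n <= L)%N ->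
  #|[set z : {ffun 'I_L -> bool} | [forall i : 'I_L, (i < n)%N ==> (z i == s i)]]|
    = (2 ^ (L - n))%N.
Proof.
move=> nL; pose F (i : 'I_L) : pred bool := fun b => (i < n)%N ==> (b == s i).
transitivity #|family F|.
  rewrite cardsE; apply: eq_card => z; rewrite !inE.
  by apply/forallP/familyP => h i; have := h i; rewrite unfold_in.
rewrite card_family foldrE big_map big_enum /=.
rewrite (eq_bigr (fun i : 'I_L => if (i < n)%N then 1%N else 2)); last first.
  move=> i _; rewrite /F; case: (i < n)%N => /=; last by rewrite card_bool.
  by rewrite -(card1 (s i)); apply: eq_card => b.
rewrite -(big_mkord xpredT (fun i => if (i < n)%N then 1%N else 2)).
rewrite (big_cat_nat (n := n)) //=.
rewrite big_nat big1 ?mul1n => [|i /andP[_ ->]] //.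
rewrite big_nat (eq_bigr (fun=> 2%N)) => [|i /andP[]]; last by rewrite leqNgt => /negPf->.
by rewrite -big_nat prod_nat_const_nat.
Qed.

Definition bit_set (L : nat) (i : 'I_L) : {set {ffun 'I_L -> bool}} :=
  [set z : {ffun 'I_L -> bool} | z i].

(** Each of the first [n] coordinates takes one value on all but an [e] fraction of [A]. Points of
    [A] with all these values lie in a cylinder of size [2 ^ (L - n)]; a union bound covers the
    others. *)
Lemma near01_bits_card (R : realType) (L n : nat) (A : {set {ffun 'I_L -> bool}})
    (e : R) :
  (n <= L)%N ->
  (forall i : 'I_L, (i < n)%N -> near01 e (density R A (bit_set i))) ->
  #|A|%:R <= (2 ^ (L - n))%:R + n%:R * e * #|A|%:R.
Proof.
move=> nL near; have [->|A0] := eqVneq A set0; first by rewrite cards0 mulr0 addr0.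
have cA : 0 < #|A|%:R :> R by rewrite ltr0n card_gt0.
pose s (i : 'I_L) := 1 - e < density R A (bit_set i).
pose C := [set z : {ffun 'I_L -> bool} | [forall i : 'I_L, (i < n)%N ==> (z i == s i)]].
pose w := widen_ord nL.
pose X (i : 'I_n) := A :&: [set z : {ffun 'I_L -> bool} | z (w i) != s (w i)].
have AX : (#|A| <= #|C| + \sum_(i < n) #|X i|)%N.
  apply: (@leq_trans #|C :|: \bigcup_i X i|).
    apply/subset_leq_card/subsetP => z Az; rewrite !inE.
    case: (boolP [forall i : 'I_L, _]) => //= /forallPn[i].
    rewrite negb_imply => /andP[i_n zi]; apply/bigcupP; exists (Ordinal i_n) => //.
    rewrite !inE Az /=; have -> : w (Ordinal i_n) = i by exact: val_inj.
    exact: zi.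
  apply: leq_trans (leq_card_setU _ _) _; rewrite leq_add2l.
  elim/big_rec2: _ => [|i m S _ IH]; first by rewrite cards0.
  by apply: leq_trans (leq_card_setU _ _) _; rewrite leq_add2l.
have Xe i : #|X i|%:R <= e * #|A|%:R.
  have := near (w i) (ltn_ord i); rewrite /X /near01 !in_itv /=.
  have cardI : #|A|%:R = #|A :&: bit_set (w i)|%:R + #|A :\: bit_set (w i)|%:R :> R.
    by rewrite -natrD cardsID.
  have [si _|si] := boolP (s (w i)).
    move: (si); rewrite /s /density ltr_pdivlMr // => lo.
    rewrite (_ : A :&: _ = A :\: bit_set (w i)); first by move: lo; rewrite cardI; lra.
    by apply/setP => z; rewrite !inE andbC; case: (z _).
  move: si; rewrite /s => /negPf->; rewrite orbF => /andP[_].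
  rewrite /density ltr_pdivrMr // => /ltW.
  rewrite (_ : [set z : {ffun 'I_L -> bool} | z (w i) != _] = bit_set (w i)) //.
  by apply/setP => z; rewrite !inE; case: (z _).
move: AX; rewrite card_cylinder // -(ler_nat R) natrD natr_sum => /le_trans; apply.
rewrite lerD2l; apply: le_trans (ler_sum _ (fun i _ => Xe i)) _.
by rewrite sumr_const card_ord -[leLHS]mulr_natl mulrA.
Qed.

(* The fiber over color [i] has [2 ^ (L - i)] elements, hence relative measure
   at least [2 ^ - (i + 1)]. *)
Definition binary_atoms (L : nat) : finType := {i : 'I_L & 'I_(2 ^ (L - i))}.

Lemma card_binary_atoms (L : nat) : (#|binary_atoms L| <= 2 ^ L.+1)%N.
Proof.
rewrite card_tagged sumnE big_map big_enum /=.
rewrite (eq_bigr (fun i : 'I_L => 2 ^ (L - i)))%N; last by move=> i _; rewrite card_ord.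
(* Reversing the order turns the exponents [L - i] into [i + 1], giving a geometric sum. *)
rewrite (reindex_inj rev_ord_inj) /=.
rewrite (eq_bigr (fun i : 'I_L => 2 * 2 ^ i))%N; last first.
  by move=> i _; rewrite -expnS; congr expn; have := ltn_ord i; lia.
rewrite -big_distrr expnS leq_mul2l /=.
by have := predn_exp 2 L; rewrite mul1n => <-; exact: leq_pred.
Qed.

Lemma card_color_class_tag (L : nat) (i : 'I_L) :
  #|color_class (fun x : binary_atoms L => tag x) i| = (2 ^ (L - i))%N.
Proof.
rewrite -[RHS](card_ord (2 ^ (L - i))%N).
pose h (k : 'I_(2 ^ (L - i))) : binary_atoms L := Tagged _ k.
rewrite -(card_imset _ (_ : injective h)); last by move=> a b /eqP; rewrite eq_Tagged => /eqP.
apply: eq_card => -[j k]; rewrite !inE /=.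
apply/eqP/imsetP => [ji|[k' _ /(congr1 tag)//]].
by case: i / ji @h => h; exists k.
Qed.

Lemma binary_atoms_gt0 (L : nat) : (0 < #|binary_atoms L.+1|)%N.
Proof.
apply/card_gt0P; exists (Tagged (fun i : 'I_L.+1 => 'I_(2 ^ (L.+1 - i))) (i := ord0)
  (Ordinal (expn_gt0 2 (L.+1 - 0)))) => //.
Qed.

(** Using [L.+1] colors keeps the vertex sets nonempty. *)
Definition bit_hypergraph (L : nat) : hypergraph :=
  @Hypergraph (binary_atoms L.+1) (binary_atoms L.+1) {ffun 'I_L.+1 -> bool}
    [set e : binary_atoms L.+1 * binary_atoms L.+1 * {ffun 'I_L.+1 -> bool} |
       (tag e.1.1 == tag e.1.2) && e.2 (tag e.1.1)]
    (binary_atoms_gt0 L) (binary_atoms_gt0 L)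
    (introT card_gt0P (ex_intro _ [ffun=> false] isT)).

Lemma matching_bit_hypergraph (L : nat) : matching_hypergraph (bit_hypergraph L).
Proof.
exists 'I_L.+1, tag, tag, (@bit_set L.+1) => x y z.
by rewrite !inE.
Qed.

Lemma fiber3_bit (L : nat) (b : binary_atoms L.+1 * binary_atoms L.+1) :
  tag b.1 = tag b.2 -> @fiber3 (bit_hypergraph L) b = bit_set (tag b.1).
Proof. by move=> b12; apply/setP => z; rewrite !inE /= b12 eqxx. Qed.

(** If coordinate [i] were bad for a part, all pairs [b] with both entries of color [i] would be
    bad. Their share is at least [4 ^ - (i + 1)], hence at least [4 ^ - n], which exceeds [e]. *)
Lemma perfect_parts_bits (R : realType) (L n : nat)
    (p : {ffun 'I_L.+1 -> bool} -> 'I_n) (e : R) :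
  (n <= L.+1)%N -> e < (4 ^ n)%:R^-1 ->
  perfect_parts (@fiber3 (bit_hypergraph L)) p e ->
  forall t, (1 <= t < n)%N -> part p t != set0 ->
  forall i : 'I_L.+1, (i < n)%N -> near01 e (density R (part p t) (bit_set i)).
Proof.
move=> nL e_lt perf t tn part0 i i_n; apply/negPn/negP => bad.
have := perf t tn part0; apply/negP; rewrite -ltNge.
pose P := color_class (fun x : binary_atoms L.+1 => tag x) i.
have badP : setX P P \subset [set b : binary_atoms L.+1 * binary_atoms L.+1 |
    ~~ near01 e (density R (part p t) (@fiber3 (bit_hypergraph L) b))].
  apply/subsetP => b; rewrite !inE => /andP[/eqP b1 /eqP b2].
  by rewrite fiber3_bit ?b1 ?b2.
have U0 : (0 < #|{: binary_atoms L.+1 * binary_atoms L.+1}|)%N.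
  by rewrite card_prod muln_gt0 binary_atoms_gt0.
apply: (@lt_le_trans _ _ ((4 ^ n)%:R^-1 * #|{: binary_atoms L.+1 * binary_atoms L.+1}|%:R)).
  by rewrite ltr_pM2r // ltr0n.
apply: (@le_trans _ _ (#|setX P P|%:R)); last by rewrite ler_nat subset_leq_card.
rewrite ler_pdivrMl ?ltr0n ?expn_gt0 // -natrM ler_nat cardsX card_color_class_tag card_prod.
apply: leq_trans (leq_mul (card_binary_atoms _) (card_binary_atoms _)) _.
rewrite -[4%N]/(2 * 2)%N expnMn mulnACA leq_mul // -expnD leq_exp2l //; lia.
Qed.

(** * Failure of approximately perfect regularity *)

Lemma matching_not_perfect (R : realType) :
  ~ approx_perfect_stable_regularity R matching_hypergraph.
Proof.
(* The exponent [n.+1] puts [f n] strictly below [4 ^ - n] and makes [n * f n] at most 1/8. *)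
pose f n : R := (4 ^ n.+1)%:R^-1.
have f01 n : 0 < f n < 1.
  rewrite invr_gt0 ltr0n expn_gt0 /= invf_lt1 ?ltr0n ?expn_gt0 //.
  by rewrite ltr1n -(exp1n n.+1) ltn_exp2r.
have q0 : 0 < 4%:R^-1 :> R by rewrite invr_gt0 ltr0n.
(* The cube is given dimension [N.+1], so it has at least [n] coordinates for every admissible
   [n]. *)
move=> /(_ _ _ q0 f01)[N /(_ _ (matching_bit_hypergraph N))].
move=> [n [nN [p1 [p2 [p3 [[_ _ small0] [_ _ perf]]]]]]].
have nL : (n <= N.+1)%N by exact: leqW.
have fn : f n < (4 ^ n)%:R^-1.
  by rewrite ltf_pV2 ?posrE ?ltr0n ?expn_gt0 // ltr_nat ltn_exp2l.
have parts := perfect_parts_bits nL fn perf.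
pose Z : finType := {ffun 'I_N.+1 -> bool}.
have cZ : #|Z| = (2 ^ n * 2 ^ (N.+1 - n))%N.
  by rewrite card_ffun card_bool card_ord -expnD subnKC.
have partE : #|Z|%:R = \sum_(t < n) #|part p3 t|%:R :> R.
  rewrite -natr_sum -sum1_card (partition_big p3 predT) //=.
  by congr _%:R; apply: eq_bigr => t _; rewrite sum1_card cardsE.
(* One bound for all labels, so that it can be summed: only label 0 is charged a quarter of the
   cube. *)
have part_le (t : 'I_n) : #|part p3 t|%:R <=
    (if (t : nat) == 0%N then 4%:R^-1 * #|Z|%:R else 0)
    + (2 ^ (N.+1 - n))%:R + n%:R * f n * #|part p3 t|%:R.
  have f_ge0 : 0 <= n%:R * f n * #|part p3 t|%:R.
    by rewrite !mulr_ge0 ?ler0n // ltW //; case/andP: (f01 n).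
  move: f_ge0; case: eqP => [->|/eqP t0] f_ge0.
    by apply: le_trans small0 _; rewrite -addrA lerDl addr_ge0 ?ler0n.
  have [->|part0] := eqVneq (part p3 t) set0.
    by rewrite cards0 mulr0 !addr0 add0r.
  rewrite add0r; apply: near01_bits_card => // i i_n.
  by apply: parts => //; rewrite lt0n t0 ltn_ord.
have n0 : (0 < n)%N by case: (p3 [ffun=> false]) => m; apply: leq_trans.
have n_le : (n * 2 <= 2 ^ n)%N.
  by case: n n0 {p1 p2 p3 small0 perf nN nL fn parts cZ partE part_le} => // m _;
     rewrite expnSr leq_mul2r ltn_expl.
have nf_le : n%:R * f n <= 8%:R^-1.
  rewrite /f ler_pdivrMr ?ltr0n ?expn_gt0 // mulrC ler_pdivlMr ?ltr0n //.
  rewrite -natrM ler_nat expnS -[8%N]/(2 * 4)%N mulnA mulnC leq_mul2l /=.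
  by apply: leq_trans n_le _; rewrite leq_exp2r.
have first_part : \sum_(t < n) (if (t : nat) == 0%N then 4%:R^-1 * #|Z|%:R else 0)
    = 4%:R^-1 * #|Z|%:R :> R.
  by rewrite -big_mkcond (big_pred1 (Ordinal n0)).
have := ler_sum (index_enum _) (fun t (_ : true) => part_le t).
rewrite -partE !big_split /= first_part -mulr_sumr -partE sumr_const card_ord.
have u0 : 0 < (2 ^ (N.+1 - n))%:R :> R by rewrite ltr0n expn_gt0.
have Z0 : 0 < #|Z|%:R :> R by rewrite ltr0n cZ muln_gt0 !expn_gt0.
have nu : (2 ^ (N.+1 - n))%:R *+ n <= 2%:R^-1 * #|Z|%:R :> R.
  rewrite ler_pdivlMl ?ltr0n // -mulrnA -natrM ler_nat cZ.
  by rewrite mulnA (mulnC 2%N) -mulnA (mulnC 2%N) mulnC leq_mul.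
(* The summed bounds give [#|Z|] at most 1/4 + 1/2 + 1/8 of itself, a contradiction. *)
have := ler_wpM2r (ltW Z0) nf_le.
move: nu; set X := _ *+ n; set Y := _ * f n * _; lra.
Qed.

Theorem theorem3 (R : realType) :
  exists F : hypergraph -> Prop,
    hereditarily_closed F /\
    strong_stable_regularity R F /\
    ~ approx_perfect_stable_regularity R F.
Proof.
exists matching_hypergraph; split; first exact: matching_hypergraph_hereditary.
split; [exact: matching_strong | exact: matching_not_perfect].
Qed.
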